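(* Let $(X,d,\mu)$ be a complete metric space equipped with a doubling Borel measure $\mu$, and suppose that $X$ satisfies an annular decay property. Then the following are equivalent: (a) $M^\natural: BMO(X)\to BLO(X)$ is bounded, i.e. there is a constant $C<\infty$ such that for every $f\in BMO(X)$ one has $M^\natural f\in BLO(X)$ and $\|M^\natural f\|_{BLO}\le C\|f\|_{BMO}$; (b) $M$ maps $A_\infty(X)$ into $A_1(X)$, i.e. $Mw\in A_1(X)$ for every $w\in A_\infty(X)$.
   Context: Balls $B=B(x,r)$ are open, and $2B=B(x,2r)$. The measure $\mu$ is doubling: there is $C_d>1$ such that $0<\mu(2B)\le C_d\,\mu(B)<\infty$ for all balls $B\subset X$. $L^1_{\mathrm{loc}}(X)$ is the set of functions integrable on every compact subset of $X$. For a ball $B$, $f_B=\frac{1}{\mu(B)}\int_B f\,d\mu$. Annular decay property: for some $0<\alpha\le 1$ there is $C\ge 1$ such that for every $x\in X$, $r>0$ and $0<\delta<1$, $\mu(B(x,r)\setminus B(x,(1-\delta)r))\le C\delta^\alpha\mu(B(x,r))$. For $f\in L^1_{\mathrm{loc}}(X)$: the Hardy–Littlewood maximal function is $Mf(x)=\sup_{B\ni x}\frac{1}{\mu(B)}\int_B|f|\,d\mu$, and the natural maximal function is $M^\natural f(x)=\sup_{B\ni x}\frac{1}{\mu(B)}\int_B f\,d\mu$, suprema over all balls $B\subset X$ containing $x$. A weight is a nonnegative function $w\in L^1_{\mathrm{loc}}(X)$ with $w>0$ $\mu$-a.e.; members of $A_1(X)$ and $A_\infty(X)$ are weights (in particular,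 locally integrable). $w\in A_1(X)$ if there is $C<\infty$ with $\frac{1}{\mu(B)}\int_B w\,d\mu\le C\operatorname{ess\,inf}_B w$ for every ball $B\subset X$. $w\in A_\infty(X)$ if $\sup_B\left(\frac{1}{\mu(B)}\int_B w\,d\mu\right)\exp\left(-\frac{1}{\mu(B)}\int_B\log w\,d\mu\right)<\infty$, supremum over all balls $B\subset X$. $BMO(X)$ consists of $f\in L^1_{\mathrm{loc}}(X)$ with $\|f\|_{BMO}=\sup_B\frac{1}{\mu(B)}\int_B|f-f_B|\,d\mu<\infty$; $BLO(X)$ consists of $f\in L^1_{\mathrm{loc}}(X)$ with $\|f\|_{BLO}=\sup_B\left(f_B-\operatorname{ess\,inf}_B f\right)<\infty$, suprema over all balls $B\subset X$. *)

(* Defs.v *)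
From HB Require Import structures.
From mathcomp Require Import all_boot all_order all_algebra.
From mathcomp Require Import all_classical all_reals all_analysis.
From mathcomp Require Import ess_sup_inf.
Import Order.TTheory GRing.Theory Num.Theory.
Import numFieldNormedType.Exports.

Set Implicit Arguments.
Unset Strict Implicit.
Unset Printing Implicit Defensive.

Local Open Scope classical_set_scope.
Local Open Scope ring_scope.
Local Open Scope ereal_scope.

#[short(type="completeMetricType")]
HB.structure Definition CompleteMetric (K : numDomainType) :=
  {M of Metric K M & Complete M}.

Definition borel (X : ptopologicalType) : measurableType (@open X).-sigma :=
  g_sigma_algebraType (@open X).

Section defs.
Context {R : realType} {X : completeMetricType R}.
Variable mu : {measure set (borel X) -> \bar R}.
Implicit Types (f w : X -> \bar R) (A B : set X).

Definition balls : set (set X) :=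
  [set B | exists (x : X) (r : R), (0 < r)%R /\ B = ball x r].

Definition doubling := exists2 Cd : R, (1 < Cd)%R &
  forall (x : X) (r : R), (0 < r)%R ->
    [/\ 0 < mu (ball x (2 * r)%R),
        mu (ball x (2 * r)%R) <= Cd%:E * mu (ball x r) &
        Cd%:E * mu (ball x r) < +oo].

Definition annular_decay := exists2 alpha : R, (0 < alpha <= 1)%R &
  exists2 C : R, (1 <= C)%R &
  forall (x : X) (r delta : R), (0 < r)%R -> (0 < delta < 1)%R ->
    mu (ball x r `\` ball x ((1 - delta) * r)%R)
      <= (C * delta `^ alpha)%:E * mu (ball x r).

Definition L1loc f := forall K : set X, compact K -> mu.-integrable K f.

Definition avg B f := (mu B)^-1 * \int[mu]_(x in B) f x.

(* [natural_max f] and [HL_max f] may take the value [+oo], so all classes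
   below consist of extended real-valued functions. *)
Definition natural_max f : X -> \bar R :=
  fun x => ereal_sup [set avg B f | B in [set B | balls B /\ B x]].

Definition HL_max f : X -> \bar R :=
  fun x => ereal_sup
    [set avg B (fun y => `|f y|) | B in [set B | balls B /\ B x]].

(* The library's [ess_inf] is over the whole space. Setting [f] to [+oo]
   outside [B] restricts it to [B]. *)
Definition ess_inf_on B f := ess_inf mu (patch (fun=> +oo) B f).

Definition weight w := [/\ L1loc w, forall x, 0 <= w x &
  {ae mu, forall x : borel X, 0 < w x}].

Definition A1 w := weight w /\
  exists C : R, forall B, balls B -> avg B w <= C%:E * ess_inf_on B w.

(* [lne] and [expeR] extend [ln] and [expR] to [\bar R], in particular
   [lne 0 = -oo] and [expeR +oo = +oo]: if [log w] has integral [-oo] over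
   some ball, then the supremum is [+oo]. *)
Definition Ainfty w := weight w /\
  ereal_sup [set avg B w * expeR (- avg B (fun x => lne (w x))) |
             B in balls] < +oo.

Definition BMO_norm f : \bar R :=
  ereal_sup [set avg B (fun x => `|f x - avg B f|) | B in balls].

Definition BMO f := L1loc f /\ BMO_norm f < +oo.

Definition BLO_norm f : \bar R :=
  ereal_sup [set avg B f - ess_inf_on B f | B in balls].

Definition BLO f := L1loc f /\ BLO_norm f < +oo.

End defs.

(* Main.v *)
Require Import Defs.
From mathcomp Require Import all_boot all_order all_algebra.
From mathcomp Require Import all_classical all_reals all_analysis.
From mathcomp Require Import ess_sup_inf measurable_realfun.
From mathcomp Require Import ring lra.
Import Order.TTheory GRing.Theory Num.Theory.
Import numFieldNormedType.Exports.

(* By doubling, the values of a maximal function on a ball B coming from balls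
   larger than B are controlled by its value at any other point of B, so that
   only small balls matter. For these a weak form of reverse Hoelder suffices:
   if on each small ball B' the value a(B') whose supremum is taken satisfies
   g >= a(B') on at least half of B', then the Vitali covering lemma gives
   mu{sup a > t} <= C mu{g > t} for every t, hence the integral of the supremum
   is at most C times that of g. This applies to
   - f in BMO with a(B') = f_{B'} - f_S - 2 |f|_BMO and g = |f - f_S|, where S
     is a dilate of B (Chebyshev's inequality);
   - w in A_infty with a(B') = c w_{B'} and g = w, since log w is in BMO and w
     is comparable on each ball to exp of the average of log w.
   Neither the John-Nirenberg inequality nor reverse Hoelder is needed, and both
   properties hold as soon as the maximal function involved is locally
   integrable. For M w this follows from (a), because M w <= K exp(M^nat log w);
   for M^nat f it follows from (b), because M^nat f <= M (1 + |f|) and 1 + |f|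
   is in A_infty. *)

Set Implicit Arguments.
Unset Strict Implicit.
Unset Printing Implicit Defensive.

Local Open Scope classical_set_scope.
Local Open Scope ring_scope.
Local Open Scope ereal_scope.

(** * Geometry of complete doubling spaces *)

(** An infinite index set would give a sequence of disjoint subsets of [S], each of measure at least
    [c], so [S] would have infinite measure. *)
Lemma trivIset_finite d (T : measurableType d) (R : realType)
    (mu : {measure set T -> \bar R}) (I : pointedType) (A : set I)
    (F : I -> set T) (S : set T) (c : R) :
  measurable S -> mu S < +oo -> (0 < c)%R -> trivIset A F ->
  (forall i, A i -> [/\ measurable (F i), F i `<=` S & c%:E <= mu (F i)]) ->
  finite_set A.
Proof.
move=> mS Soo c0 tAF FA; apply: contrapT => /infiniteP/pcard_leP[f].
have fA n : A (f n) by exact: (@funS _ _ _ _ f).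
have tF : trivIset setT (F \o f).
  move=> i j _ _ Fij; have := tAF _ _ (fA i) (fA j) Fij.
  by move/(@inj _ _ _ f) => ->//; rewrite inE.
have mF n : measurable ((F \o f) n) by case: (FA _ (fA n)).
have : mu (\bigcup_n (F \o f) n) < +oo.
  apply: le_lt_trans Soo; apply: le_measure; rewrite ?inE//.
    exact: bigcupT_measurable.
  by move=> x [n _]; case: (FA _ (fA n)) => _ + _; exact.
rewrite ltNge; apply/negP; rewrite negbK leye_eq; apply/eqP.
rewrite measure_bigcup// (@eq_eseriesl _ _ xpredT); last first.
  by move=> n; rewrite in_setT.
apply/eqyP => M M0.
pose n := Num.truncn (M / c).
apply: (@le_trans _ _ (\sum_(0 <= i < n.+1) mu ((F \o f) i))); last first.
  by apply: nneseries_lim_ge => // i _ _; exact: measure_ge0.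
apply: (@le_trans _ _ (\sum_(0 <= i < n.+1) c%:E)); last first.
  by apply: lee_sum => i _; case: (FA _ (fA i)).
rewrite sumEFin lee_fin big_const_nat subn0 iter_addr addr0 -mulr_natr.
by rewrite -ler_pdivrMl// mulrC ltW// truncnS_gt.
Qed.

Section geometry.
Context {R : realType} {X : completeMetricType R}.
Implicit Types (x y z : X) (r s : R).

Lemma sub_ball x y r s : (mdist x y + s <= r)%R -> ball y s `<=` ball x r.
Proof.
move=> h z; rewrite !ballEmdist/= => yz.
by apply: le_lt_trans (metric_triangle x y z) _; lra.
Qed.

Lemma open_metric_ball x r : open (ball x r).
Proof.
rewrite openE => y; rewrite ballEmdist/= => xy.
rewrite /interior -nbhs_ballE; exists (r - mdist x y)%R => /=.
  by rewrite subr_gt0.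
by rewrite -[X in _ `<=` X]ballEmdist; apply: sub_ball; lra.
Qed.

Lemma measurable_open (A : set X) : open A -> measurable (A : set (borel X)).
Proof. exact: sub_sigma_algebra. Qed.

Lemma measurable_metric_ball x r : measurable (ball x r : set (borel X)).
Proof. apply: measurable_open; exact: open_metric_ball. Qed.

Lemma metric_compact_measurable (K : set X) :
  compact K -> measurable (K : set (borel X)).
Proof.
move=> cK; rewrite -(setCK K); apply: measurableC; apply: measurable_open.
by apply: closed_openC; apply: compact_closed => //; exact: metric_hausdorff.
Qed.

Lemma compact_sub_ball (K : set X) x :
  compact K -> exists2 r, (0 < r)%R & K `<=` ball x r.
Proof.
rewrite compact_cover => /(_ nat setT (fun n => ball x n.+1%:R)).
case.
- by move=> n _; exact: open_metric_ball.
- move=> y _; exists (Num.truncn (mdist x y)) => //.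
  by rewrite ballEmdist/= truncnS_gt.
(* The sum of the radii in the finite subcover stands in for their maximum; the final [1] keeps it
   positive when the subcover is empty. *)
move=> D _ KD; exists (\sum_(i <- finmap.enum_fset D) i.+1%:R + 1)%R.
  by rewrite ltr_pwDr// sumr_ge0.
move=> y /KD[n /= nD]; apply: le_ball.
rewrite (bigD1_seq n nD (finmap.fset_uniq D))/= -addrA lerDl addr_ge0//.
by rewrite sumr_ge0.
Qed.

(** [doubling] with its constant as a parameter, so that later estimates can be explicit in [Cd]. *)
Definition doubling_by (mu : {measure set (borel X) -> \bar R}) (Cd : R) :=
  (1 < Cd)%R /\ forall x r, (0 < r)%R ->
    [/\ 0 < mu (ball x (2 * r)%R),
        mu (ball x (2 * r)%R) <= Cd%:E * mu (ball x r) &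
        Cd%:E * mu (ball x r) < +oo].

Context (mu : {measure set (borel X) -> \bar R}) (Cd : R).
Hypothesis mu_dbl : doubling_by mu Cd.

Let mu_doubling := mu_dbl.2.

Let Cd0 : (0 < Cd)%R. Proof. exact: lt_trans mu_dbl.1. Qed.

Lemma mu_ball_gt0 x r : (0 < r)%R -> 0 < mu (ball x r).
Proof.
move=> r0; have r20 : (0 < r / 2)%R by lra.
by have [+ _ _] := mu_doubling x r20; rewrite (_ : 2 * (r / 2) = r)%R//; lra.
Qed.

Lemma mu_ball_ltey x r : (0 < r)%R -> mu (ball x r) < +oo.
Proof.
move=> r0; have [_ _] := mu_doubling x r0.
have := measure_ge0 mu (ball x r); case: (mu _) => [m|_|//].
  by move=> *; rewrite ltry.
by rewrite gt0_muley// lte_fin.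
Qed.

Lemma mu_ball_fin x r : (0 < r)%R -> mu (ball x r) \is a fin_num.
Proof. by move=> r0; rewrite ge0_fin_numE ?measure_ge0 ?mu_ball_ltey. Qed.

Lemma mu_ball_pow k x r : (0 < r)%R ->
  mu (ball x (2 ^+ k * r)%R) <= (Cd ^+ k)%:E * mu (ball x r).
Proof.
move=> r0; elim: k => [|k IH]; first by rewrite !expr0 mul1r mul1e.
have r0' : (0 < 2 ^+ k * r)%R by rewrite mulr_gt0// exprn_gt0.
have [_ h _] := mu_doubling x r0'.
rewrite exprS -mulrA (le_trans h)// exprS EFinM -muleA lee_pmul2l// ?lte_fin.
Qed.

Lemma le_mu (A B : set X) : measurable (A : set (borel X)) ->
  measurable (B : set (borel X)) -> A `<=` B -> mu A <= mu B.
Proof. by move=> mA mB AB; apply: le_measure; rewrite ?inE. Qed.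

Lemma mu_ball_sub k x y r s : (0 < s)%R -> (mdist y x + r <= 2 ^+ k * s)%R ->
  mu (ball x r) <= (Cd ^+ k)%:E * mu (ball y s).
Proof.
move=> s0 h; apply: le_trans (mu_ball_pow k y s0).
by apply: le_mu; [exact: measurable_metric_ball..|exact: sub_ball].
Qed.

(** Take a maximal set of centres whose [e / 2]-balls are disjoint. It is finite, since each of
    these balls carries a fixed fraction of the measure of [ball x (r + e)]; by maximality the
    [e]-balls around it cover. *)
Lemma ball_totally_bounded x r e : (0 < r)%R -> (0 < e)%R ->
  exists2 D : set X, finite_set D & ball x r `<=` \bigcup_(y in D) ball y e.
Proof.
move=> r0 e0.
have e20 : (0 < e / 2)%R by lra.
have [D [Dx tD maxD]] :=
  ex_maximal_disjoint_subcollection (fun y => ball y (e / 2)) (ball x r).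
exists D.
  pose k := Num.truncn ((2 * r + e) / (e / 2)).
  (* With this exponent, [k.+1] doublings of an [e / 2]-ball centred in [ball x r] swallow
     [ball x (r + e)]. *)
  have hk : (2 * r + e <= 2 ^+ k.+1 * (e / 2))%R.
    rewrite -ler_pdivrMr//; apply/ltW; apply: lt_le_trans (truncnS_gt _) _.
    by rewrite -/k -natrX ler_nat ltnW// ltn_expl.
  have mB : 0 < mu (ball x (r + e)%R) by apply: mu_ball_gt0; lra.
  pose c := (fine (mu (ball x (r + e)%R)) / Cd ^+ k.+1)%R.
  have fB : mu (ball x (r + e)%R) \is a fin_num by apply: mu_ball_fin; lra.
  have Ck : (0 < Cd ^+ k.+1)%R by rewrite exprn_gt0.
  apply: (@trivIset_finite _ _ _ mu _ D (fun y => ball y (e / 2)%R)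
    (ball x (r + e)%R) c) => //.
  - exact: measurable_metric_ball.
  - by apply: mu_ball_ltey; lra.
  - by rewrite divr_gt0// fine_gt0// mB ltey_eq fB.
  move=> y /Dx; rewrite ballEmdist/= => xy; split.
  - exact: measurable_metric_ball.
  - by apply: sub_ball; lra.
  have : mu (ball x (r + e)%R) <= (Cd ^+ k.+1)%:E * mu (ball y (e / 2)%R).
    by apply: mu_ball_sub => //; rewrite (metric_sym y); lra.
  rewrite /c -lee_pdivrMl// => h.
  by apply: le_trans h; rewrite mulrC EFinM fineK.
move=> z xz; apply: contrapT => nz.
have Dz : ~ D z by move=> Dz; apply: nz; exists z => //; exact: ballxx.
apply: (maxD (D `|` [set z])).
- by split=> [|h]; [exact: subsetUl|apply: Dz; apply: h; right].
- by rewrite subUset; split => // _ ->.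
have disj y : D y -> ball y (e / 2)%R `&` ball z (e / 2)%R !=set0 -> False.
  move=> Dy [u []]; rewrite !ballEmdist/= => yu zu; apply: nz; exists y => //.
  rewrite ballEmdist/=; apply: le_lt_trans (metric_triangle y u z) _.
  by move: zu; rewrite (metric_sym z); lra.
move=> i j [Di|->] [Dj|->]//; first exact: tD.
- by move=> /(disj _ Di).
- by rewrite setIC => /(disj _ Dj).
Qed.

(** Completeness enters here: an ultrafilter containing the closure is Cauchy by total boundedness,
    hence converges. *)
Lemma compact_closure_ball x r : (0 < r)%R -> compact (closure (ball x r)).
Proof.
move=> r0; rewrite compact_ultra => F UF FB.
have Fr : F (ball x (r + 1)%R).
  apply: filterS FB => y /(_ _ (nbhsx_ballx y 1%R ltr01))[z []].
  rewrite !ballEmdist/= => xz yz.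
  by apply: le_lt_trans (metric_triangle x z y) _; rewrite (metric_sym z); lra.
have : cauchy F.
  apply: cauchy_exP => e e0.
  have [|_ /finite_fsetP[D ->] DB] := @ball_totally_bounded x (r + 1)%R e _ e0.
    lra.
  (* If no [e]-ball belonged to the ultrafilter, the complements of the finitely many covering balls
     all would, but their intersection with [ball x (r + 1)] is empty. *)
  apply: contrapT => /forallNP h.
  have Fc y : F (~` ball y e).
    by have [/h|] := in_ultra_setVsetC (ball y e) UF.
  have FF : Filter F by typeclasses eauto.
  have := @filter_bigI _ _ D (fun y => ~` ball y e) F FF (fun y _ => Fc y).
  move=> /(filterI Fr)/filter_ex[y [/DB[z Dz zy]]] /(_ z Dz).
  exact.
move=> /cauchy_cvg cF; exists (lim F); split => //.
apply: closed_closure => B /cF FB'.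
by have [y [? ?]] := filter_ex (filterI FB FB'); exists y.
Qed.

End geometry.

(** * The Vitali covering lemma *)

Section vitali.
Context {R : realType} {X : completeMetricType R}.
Local Notation Bl := (fun p : X * R => ball p.1 p.2).

(** Zorn's lemma is applied to the disjoint subfamilies such that every ball of [F] meeting one of
    their balls meets one of at least half its own radius. A maximal one meets every ball of [F],
    and the triangle inequality gives the factor 5. *)
Lemma vitali_cover (F : set (X * R)) (rho : R) :
  (forall p, F p -> 0 < p.2 <= rho)%R ->
  exists W : set (X * R), [/\ W `<=` F, trivIset W Bl &
    forall p, F p -> exists2 q, W q & Bl p `<=` ball q.1 (5 * q.2)%R].
Proof.
move=> Frho.
pose meet p q := Bl p `&` Bl q !=set0.
pose P (A : set (X * R)) := [/\ A `<=` F, trivIset A Bl &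
  forall p, F p -> (exists2 q, A q & meet p q) ->
    exists q, [/\ A q, meet p q & p.2 <= 2 * q.2]%R].
have [C CP totC|A [[AF tA domA] maxA]] := @Zorn_bigcup _ P.
  split.
  - by apply: bigcup_sub => A /CP[].
  - move=> i j [A CA Ai] [B CB Bj] ij.
    have [AB|BA] := totC _ _ CA CB.
    + by have [_ t _] := CP _ CB; apply: t => //; exact: AB.
    + by have [_ t _] := CP _ CA; apply: t => //; exact: BA.
  - move=> p Fp [q [A CA Aq] pq].
    have [_ _ /(_ p Fp)[|q' [Aq' ? ?]]] := CP _ CA; first by exists q.
    by exists q'; split => //; exists A.
have meetA p : F p -> exists2 q, A q & meet p q.
  move=> Fp; apply: contrapT => nmeet.
  (* Among the balls that miss [A], one whose radius exceeds half the supremum can be added to [A],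
     against maximality. *)
  pose G := [set p | F p /\ ~ exists2 q, A q & meet p q].
  have sG : has_sup [set p.2 | p in G].
    split; first by exists p.2, p.
    by exists rho => _ [q [/Frho/andP[_ ?] _] <-].
  have p20 : (0 < p.2)%R by have /andP[] := Frho p Fp.
  have sp : (p.2 <= sup [set p.2 | p in G])%R.
    by apply: ub_le_sup; [exact: sG.2|exists p].
  have e0 : (0 < sup [set p.2 | p in G] / 2)%R by lra.
  have [_ [p1 [Fp1 np1] <-] sp1] := sup_adherent e0 sG.
  have p1c : Bl p1 p1.1 by apply: ballxx; have /andP[] := Frho p1 Fp1.
  have Ap1 : ~ A p1 by move=> Ap1; apply: np1; exists p1 => //; exists p1.1.
  apply: (maxA (A `|` [set p1])).
    by split => [|h]; [exact: subsetUl|apply: Ap1; apply: h; right].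
  split.
  - by rewrite subUset; split => // _ ->.
  - move=> i j [Ai|->] [Aj|->] // ij; first exact: tA.
    + by exfalso; apply: np1; exists i => //; rewrite /meet setIC.
    + by exfalso; apply: np1; exists j.
  - move=> q Fq [q' Aq' qq'].
    have [mq|nmq] := pselect (exists2 t, A t & meet q t).
      by have [t [At qt ?]] := domA q Fq mq; exists t; split => //; left.
    exists q'; split => //; case: Aq' => [Aq'|->].
      by case: nmq; exists q'.
    have : (q.2 <= sup [set p.2 | p in G])%R.
      by apply: ub_le_sup; [exact: sG.2|exists q].
    by move: sp1; lra.
exists A; split => // p Fp.
have [q [Aq [u [pu qu]] pq]] := domA p Fp (meetA p Fp); exists q => // z.
move: pu qu; rewrite !ballEmdist/= => pu qu pz.
have := metric_triangle q.1 u z; have := metric_triangle u p.1 z.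
rewrite (metric_sym u p.1); lra.
Qed.

End vitali.

Section vitali_measure.
Context {R : realType} {X : completeMetricType R}.
Context (mu : {measure set (borel X) -> \bar R}) (Cd : R).
Hypothesis mu_dbl : doubling_by mu Cd.
Local Notation Bl := (fun p : X * R => ball p.1 p.2).

Let Cd0 : (0 < Cd)%R. Proof. exact: lt_trans mu_dbl.1. Qed.

(** Balls have positive measure, and for each [n] only finitely many disjoint ones inside [S] have
    measure at least [1 / (n + 1)]. *)
Lemma disjoint_balls_countable (W : set (X * R)) (S : set X) :
  measurable (S : set (borel X)) -> mu S < +oo -> trivIset W Bl ->
  (forall p, W p -> (0 < p.2)%R /\ Bl p `<=` S) -> countable W.
Proof.
move=> mS Soo tW WS.
have -> : W = \bigcup_n [set p | W p /\ (n.+1%:R^-1)%:E <= mu (Bl p)].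
  apply/seteqP; split => [p Wp|p [n _ []//]].
  have [p0 _] := WS p Wp.
  have mp := mu_ball_gt0 mu_dbl p.1 p0.
  have fp := mu_ball_fin mu_dbl p.1 p0.
  have f0 : (0 < fine (mu (Bl p)))%R by rewrite fine_gt0// mp ltey_eq fp.
  exists (Num.truncn (fine (mu (Bl p)))^-1) => //; split => //.
  rewrite -(fineK fp) lee_fin invf_ple ?posrE// ltW//.
  exact: truncnS_gt.
apply: bigcup_countable => // n _; apply: finite_set_countable.
apply: (@trivIset_finite _ _ _ mu _ _ Bl S (n.+1%:R^-1)) => //.
  by move=> i j [Wi _] [Wj _]; exact: tW.
move=> p [Wp h]; have [_ ?] := WS p Wp; split => //.
exact: measurable_metric_ball.
Qed.

(** The balls of a disjoint Vitali subfamily, enlarged five times, cover the union. As 5 is at most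
    8, enlarging costs [Cd ^+ 3]; passing to the parts in [G] costs 2, and these parts are disjoint
    subsets of [S]. *)
Lemma vitali_measure (F : set (X * R)) (rho : R) (S G : set X) :
  (forall p, F p -> 0 < p.2 <= rho)%R ->
  measurable (S : set (borel X)) -> mu S < +oo ->
  (forall p, F p -> Bl p `<=` S) ->
  measurable (G : set (borel X)) ->
  (forall p, F p -> mu (Bl p) <= 2%:E * mu (Bl p `&` G)) ->
  mu (\bigcup_(p in F) Bl p) <= (2 * Cd ^+ 3)%:E * mu (S `&` G).
Proof.
move=> Frho mS Soo FS mG FG.
have [W [WF tW WB]] := vitali_cover Frho.
have /countable_injP[c cinj] : countable W.
  apply: (disjoint_balls_countable mS Soo tW) => p /WF Fp.
  by split; [have /andP[] := Frho p Fp|exact: FS].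
(* The countable family is enumerated by its codes, with [e] decoding them; numbers outside [D] get
   the empty set. *)
pose D := c @` W.
pose e n := 'pinv_(fun=> point) W c n.
have We n : D n -> W (e n).
  by move=> Dn; rewrite -(injpinv_image (fun=> point) cinj); exists n.
have ce n : D n -> c (e n) = n by move=> Dn; rewrite /e pinvK// inE.
have ec p : W p -> e (c p) = p by move=> Wp; rewrite /e pinvKV// inE.
pose A n := if n \in D then ball (e n).1 (5 * (e n).2)%R else set0.
have mA n : measurable (A n : set (borel X)).
  by rewrite /A; case: ifPn => _ //; exact: measurable_metric_ball.
have mU : measurable ((\bigcup_(p in F) Bl p) : set (borel X)).
  by apply: measurable_open; apply: bigcup_open => p _; exact: open_metric_ball.
have UA : \bigcup_(p in F) Bl p `<=` \bigcup_n A n.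
  move=> x [p Fp px]; have [q Wq pq] := WB p Fp.
  by exists (c q) => //; rewrite /A mem_set ?ec//; [exact: pq|exists q].
apply: (le_trans (measure_sigma_subadditive mu mA mU UA)).
apply: (@le_trans _ _ (\sum_(0 <= n <oo)
    (2 * Cd ^+ 3)%:E * (if n \in D then mu (Bl (e n) `&` G) else 0))).
  apply: lee_nneseries => // n _; rewrite /A; case: ifPn => [/set_mem Dn|_].
    have Fe := WF _ (We n Dn).
    have e0 : (0 < (e n).2)%R by have /andP[] := Frho _ Fe.
    have h : mu (ball (e n).1 (5 * (e n).2)%R) <= (Cd ^+ 3)%:E * mu (Bl (e n)).
      by apply: (mu_ball_sub mu_dbl) => //; rewrite mdistxx; lra.
    apply: (le_trans h); rewrite (_ : (2 * Cd ^+ 3)%:E = (Cd ^+ 3)%:E * 2%:E).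
      rewrite -muleA.
      by apply: lee_wpmul2l; [rewrite lee_fin exprn_ge0// ltW|exact: FG].
    by rewrite -EFinM mulrC.
  by rewrite measure0 mule0.
rewrite nneseriesZl; last by move=> i _; case: ifP.
rewrite lee_pmul2l// ?lte_fin ?mulr_gt0 ?exprn_gt0//.
rewrite -eseries_mkcond -measure_bigcup/=.
- apply: le_mu => //.
  + apply: bigcup_measurable => n _; apply: measurableI => //.
    exact: measurable_metric_ball.
  + exact: measurableI.
  + by move=> x [n Dn [? ?]]; split => //; apply: (FS (e n)) => //; exact/WF/We.
- by move=> n _; apply: measurableI => //; exact: measurable_metric_ball.
- move=> i j Di Dj [x [[xi _] [xj _]]]; rewrite -(ce i Di) -(ce j Dj).
  by congr c; apply: tW; [exact: We|exact: We|exists x].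
Qed.

End vitali_measure.

(** * Suprema over small balls *)

Section layers.
Context {R : realType} (e : R) (e0 : (0 < e)%R).
Implicit Type t : \bar R.

Let layer t n : \bar R := (e * ((n%:R * e)%:E < t)%E%:R)%:E.

Let layer_ge0 t n : 0 <= layer t n.
Proof. by rewrite lee_fin mulr_ge0// ltW. Qed.

(** A discrete layer cake formula: for nonnegative [t] the sum is [e] times the number of [n] with
    [n e < t], that is, [t] rounded up to a multiple of [e]. *)
Lemma le_sum_layers t :
  t <= \sum_(0 <= n <oo) (e * ((n%:R * e)%:E < t)%E%:R)%:E.
Proof.
(* Bounding partial sums below by a minimum treats finite and infinite [t] alike. *)
have le N : Order.min (N%:R * e)%:E t <= \sum_(0 <= n < N) layer t n.
  elim: N => [|N IH]; first by rewrite mul0r big_nil ge_min lexx.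
  rewrite big_nat_recr//= /layer; have [Nt|tN] := ltP (N%:R * e)%:E t.
    rewrite mulr1 ge_min -natr1 mulrDl mul1r EFinD leeD2r//.
    by apply: le_trans IH; rewrite le_min lexx ltW.
  rewrite mulr0 adde0 ge_min; apply/orP; right; apply: le_trans IH.
  by rewrite le_min tN lexx.
have lim N : \sum_(0 <= n < N) layer t n <= \sum_(0 <= n <oo) layer t n.
  exact: nneseries_lim_ge.
case: t le lim => [t| |] le lim; last by rewrite leNye.
  pose N := (Num.truncn (t / e)).+1.
  apply: le_trans (lim N); apply: le_trans (le N); rewrite le_min lexx andbT.
  by rewrite lee_fin -ler_pdivrMr// ltW// truncnS_gt.
rewrite leye_eq; apply/eqP/eqyP => A A0.
pose N := (Num.truncn (A / e)).+1.
apply: le_trans (lim N); apply: le_trans (le N); rewrite le_min leey andbT.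
by rewrite lee_fin -ler_pdivrMr// ltW// truncnS_gt.
Qed.

(** Rounding up to a multiple of [e] adds at most [e]. *)
Lemma sum_layers_le t : 0 <= t ->
  \sum_(0 <= n <oo) (e * ((n%:R * e)%:E < t)%E%:R)%:E <= e%:E + t.
Proof.
move=> t0; apply: lime_le.
  by apply: is_cvg_nneseries => n _ _; exact: layer_ge0.
apply: nearW.
suff le N : \sum_(0 <= n < N) layer t n <= (N%:R * e)%:E /\
    \sum_(0 <= n < N) layer t n <= e%:E + t by move=> N; case: (le N).
elim: N => [|N [IH1 IH2]].
  by rewrite mul0r big_nil adde_ge0// lee_fin ltW.
rewrite big_nat_recr//= /layer; have [Nt|tN] := ltP (N%:R * e)%:E t.
  rewrite mulr1 -natr1 mulrDl mul1r EFinD; split; first exact: leeD2r.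
  by rewrite addeC leeD2l// (le_trans IH1)// ltW.
rewrite mulr0 adde0; split=> //; apply: (le_trans IH1).
by rewrite lee_fin; apply: ler_wpM2r; [exact: ltW|rewrite ler_nat].
Qed.

End layers.

Section sup_over_balls.
Context {R : realType} {X : completeMetricType R}.
Context (mu : {measure set (borel X) -> \bar R}) (Cd : R).
Hypothesis mu_dbl : doubling_by mu Cd.
Local Notation Bl := (fun p : X * R => ball p.1 p.2).

Let Cd0 : (0 < Cd)%R. Proof. exact: lt_trans mu_dbl.1. Qed.

(** Balls are indexed by centre and radius, which the underlying set need not determine. Including
    [0] makes the supremum nonnegative even where no ball of [F] passes. *)
Definition sup_balls (F : set (X * R)) (a : X * R -> R) (x : X) : \bar R :=
  ereal_sup ([set 0] `|` [set (a p)%:E | p in [set p | F p /\ Bl p x]]).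

Context (F : set (X * R)) (a : X * R -> R).

Lemma sup_balls_ge0 x : 0 <= sup_balls F a x.
Proof. by apply: ereal_sup_ubound; left. Qed.

Lemma sup_balls_ge p x : F p -> Bl p x -> (a p)%:E <= sup_balls F a x.
Proof. by move=> Fp px; apply: ereal_sup_ubound; right; exists p. Qed.

(** Superlevel sets are thus open, which gives measurability, and have the form to which the
    covering lemma applies. *)
Lemma sup_balls_gt (t : R) : (0 <= t)%R ->
  [set x | t%:E < sup_balls F a x] =
  \bigcup_(p in [set p | F p /\ (t < a p)%R]) Bl p.
Proof.
move=> t0; apply/seteqP; split=> [x|x [p [Fp tp] px]].
  move=> /ereal_sup_gt[_ [->|[p [Fp px] <-]]].
    by rewrite lte_fin ltNge t0.
  by rewrite lte_fin => tp; exists p.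
by apply: lt_le_trans (sup_balls_ge Fp px); rewrite lte_fin.
Qed.

Lemma measurable_sup_balls (D : set X) : measurable (D : set (borel X)) ->
  @measurable_fun _ _ (borel X) _ D (sup_balls F a).
Proof.
move=> mD; apply: measurable_funTS.
apply: (measurability _ (@ErealGenOInfty.measurableE R)).
move=> _ [_ [t ->] <-]; rewrite setTI.
have [t0|t0] := leP 0%R t.
  rewrite (_ : _ @^-1` _ = [set x | t%:E < sup_balls F a x]); last first.
    by apply/seteqP; split => x /=; rewrite in_itv/= andbT.
  rewrite sup_balls_gt//; apply: measurable_open; apply: bigcup_open => p _.
  exact: open_metric_ball.
rewrite (_ : _ @^-1` _ = setT); first exact: measurableT.
apply/seteqP; split => x //= _; rewrite in_itv/= andbT.
by apply: lt_le_trans (sup_balls_ge0 x); rewrite lte_fin.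
Qed.

Context (rho : R) (S : set X) (g : X -> \bar R).
Hypotheses (Frho : forall p, F p -> (0 < p.2 <= rho)%R)
  (mS : measurable (S : set (borel X))) (Soo : mu S < +oo)
  (FS : forall p, F p -> Bl p `<=` S)
  (mg : @measurable_fun _ _ (borel X) _ S g)
  (g0 : forall x, S x -> 0 <= g x)
  (Fg : forall p, F p ->
     mu (Bl p) <= 2%:E * mu (Bl p `&` [set x | (a p)%:E <= g x])).

(** The set where the supremum exceeds [n e] is a union of balls on at least half of which
    [g > n e]. The covering lemma bounds its measure by that of [G n], and the layers are summed.
    The term [e%:E * mu S] is the rounding error. *)
Lemma integral_sup_balls (e : R) : (0 < e)%R ->
  \int[mu]_(x in S) sup_balls F a x <=
  (2 * Cd ^+ 3)%:E * (e%:E * mu S + \int[mu]_(x in S) g x).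
Proof.
move=> e0.
pose E n : set (borel X) := [set x | (n%:R * e)%:E < sup_balls F a x].
pose G n : set (borel X) := S `&` [set x | (n%:R * e)%:E < g x].
have ne0 n : (0 <= n%:R * e)%R by rewrite mulr_ge0// ltW.
have mE n : measurable (E n).
  rewrite /E sup_balls_gt//; apply: measurable_open.
  by apply: bigcup_open => p _; exact: open_metric_ball.
have mG n : measurable (G n).
  exact: emeasurable_fun_o_infty.
have indE n x : (e * ((n%:R * e)%:E < sup_balls F a x)%E%:R)%:E =
    e%:E * (\1_(E n) x)%:E :> \bar R.
  by rewrite -EFinM indicE /E mem_setE.
have indG n x : S x -> (e * ((n%:R * e)%:E < g x)%E%:R)%:E =
    e%:E * (\1_(G n) x)%:E :> \bar R.
  by move=> Sx; rewrite -EFinM indicE /G in_setI mem_set// mem_setE.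
have mind (H : set (borel X)) : measurable H ->
    @measurable_fun _ _ (borel X) _ S (fun x => e%:E * (\1_H x)%:E).
  move=> mH; apply: measurable_funeM; apply/measurable_EFinP.
  exact: measurable_indic.
have ind0 (H : set (borel X)) x : 0 <= e%:E * (\1_H x)%:E :> \bar R.
  by rewrite -EFinM lee_fin mulr_ge0// ltW.
have int_ind (H : set (borel X)) : measurable H ->
    \int[mu]_(x in S) (e%:E * (\1_H x)%:E) = e%:E * mu (H `&` S).
  move=> mH; rewrite ge0_integralZl_EFin//.
  - by rewrite integral_indic.
  - by apply/measurable_EFinP; exact: measurable_indic.
  - exact: ltW.
have muEG n : mu (E n `&` S) <= (2 * Cd ^+ 3)%:E * mu (G n `&` S).
  apply: (@le_trans _ _ (mu (E n))).
    by apply: le_mu => //; exact: measurableI.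
  have -> : G n `&` S = S `&` G n by rewrite setIC.
  rewrite /E sup_balls_gt//.
  apply: (vitali_measure mu_dbl (rho := rho)) => //.
  - by move=> p [Fp _]; exact: Frho.
  - by move=> p [Fp _]; exact: FS.
  - move=> p [Fp np]; apply: (le_trans (Fg Fp)).
    apply: lee_wpmul2l => //; apply: le_mu.
    + rewrite (_ : _ `&` _ = Bl p `&` (S `&` [set x | (a p)%:E <= g x])).
        apply: measurableI; first exact: (measurable_metric_ball p.1 p.2).
        exact: emeasurable_fun_c_infty.
      by rewrite setIA (setIidl (FS Fp)).
    + apply: measurableI; last exact: mG.
      exact: (measurable_metric_ball p.1 p.2).
    + move=> x [px ax]; split => //; split; first exact: FS px.
      by apply: lt_le_trans ax; rewrite lte_fin.
apply: (@le_trans _ _ (\int[mu]_(x in S)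
    \sum_(0 <= n <oo) (e%:E * (\1_(E n) x)%:E))).
  apply: ge0_le_integral => //.
  - by move=> x _; exact: sup_balls_ge0.
  - exact: measurable_sup_balls.
  - by apply: ge0_emeasurable_sum => n x *; [exact: ind0|exact: mind].
  - move=> x _; under eq_eseriesr do rewrite -indE.
    exact: le_sum_layers.
rewrite integral_nneseries//; last by move=> n; exact: mind.
apply: (@le_trans _ _ (\sum_(0 <= n <oo)
    (2 * Cd ^+ 3)%:E * \int[mu]_(x in S) (e%:E * (\1_(G n) x)%:E))).
  apply: lee_nneseries => n _; first by move=> _; apply: integral_ge0.
  rewrite !int_ind// muleCA lee_wpmul2l//.
  by rewrite lee_fin ltW.
have C0 : (0 <= 2 * Cd ^+ 3)%R by rewrite mulr_ge0// exprn_ge0// ltW.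
rewrite nneseriesZl; last by move=> n _; exact: integral_ge0.
apply: lee_wpmul2l; first by rewrite lee_fin.
rewrite -integral_nneseries//; last by move=> n; exact: mind.
rewrite -[e%:E * mu S]integral_cst// -ge0_integralD//; last first.
  by move=> x _; rewrite lee_fin ltW.
apply: ge0_le_integral => //.
- by move=> x _; apply: nneseries_ge0 => n _ _; exact: ind0.
- by apply: ge0_emeasurable_sum => n x *; [exact: ind0|exact: mind].
- exact: emeasurable_funD.
- move=> x Sx; under eq_eseriesr do rewrite -indG//.
  by apply: sum_layers_le => //; exact: g0.
Qed.

End sup_over_balls.

(** * Averages *)

Section lne_measurable.
Context {R : realType}.

Lemma lte_lne_expR (t : R) (x : \bar R) : (t%:E < lne x) = ((expR t)%:E < x).
Proof.
have [x0|x0] := ltP x 0.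
  rewrite le0_lneNy ?(ltW x0)// ltNge leNye/=; apply/esym/negbTE.
  by rewrite -leNgt (le_trans (ltW x0))// lee_fin expR_ge0.
by rewrite -lte_expeR lneK// in_itv/= x0 leey.
Qed.

Lemma measurable_lne : measurable_fun [set: \bar R] (@lne R).
Proof.
apply: (measurability _ (@ErealGenOInfty.measurableE R)).
move=> _ [_ [t ->] <-]; rewrite setTI.
rewrite (_ : _ @^-1` _ = `](expR t)%:E, +oo[%classic); last first.
  by apply/seteqP; split => x /=; rewrite !in_itv/= !andbT lte_lne_expR.
exact: emeasurable_itv.
Qed.

Lemma lne_le (x : \bar R) : 0 <= x -> lne x <= x.
Proof.
case: x => [x x0|//|//]; exact: ltW (lne_sublinear _).
Qed.

End lne_measurable.

Section averages.
Context {R : realType} {X : completeMetricType R}.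
Context (mu : {measure set (borel X) -> \bar R}).

(** What the calculus of averages takes from balls: division by [mu B] becomes multiplication by a
    positive real. *)
Definition posfin (B : set X) :=
  [/\ measurable (B : set (borel X)), 0 < mu B & mu B < +oo].

Context (B : set X).
Hypothesis pfB : posfin B.
Implicit Types (f g : X -> \bar R) (c : R).
Local Notation mfun f := (@measurable_fun _ _ (borel X) _ B f).

Let mB : measurable (B : set (borel X)). Proof. by case: pfB. Qed.
Let B0 : 0 < mu B. Proof. by case: pfB. Qed.
Let Boo : mu B < +oo. Proof. by case: pfB. Qed.

Let fB : mu B \is a fin_num.
Proof. by rewrite ge0_fin_numE. Qed.

Let m0 : (0 < fine (mu B))%R. Proof. by rewrite fine_gt0// B0 ltey_eq fB. Qed.

Let im0 : 0 <= ((fine (mu B))^-1)%:E.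
Proof. by rewrite lee_fin invr_ge0 ltW. Qed.

Lemma avgE f : avg mu B f = ((fine (mu B))^-1)%:E * \int[mu]_(x in B) f x.
Proof. by rewrite /avg -[in LHS](fineK fB) inver gt_eqF. Qed.

Lemma avgK f : mu B * avg mu B f = \int[mu]_(x in B) f x.
Proof.
by rewrite avgE muleA -{1}(fineK fB) -EFinM divff ?gt_eqF// mul1e.
Qed.

Lemma avg_le_mul f (k : \bar R) :
  \int[mu]_(x in B) f x <= k * mu B -> avg mu B f <= k.
Proof. by move=> h; rewrite avgE lee_pdivrMl// fineK// muleC. Qed.

Lemma avg_ge0 f : (forall x, B x -> 0 <= f x) -> 0 <= avg mu B f.
Proof.
move=> f0; rewrite avgE mule_ge0//.
exact: integral_ge0.
Qed.

Lemma integrable_cst c : mu.-integrable B (cst c%:E).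
Proof.
apply/integrableP; split; first exact: measurable_cst.
by rewrite integral_cst// lte_mul_pinfty// ?abse_ge0// abse_fin_num.
Qed.

Lemma avg_cst c : avg mu B (cst c%:E) = c%:E.
Proof.
rewrite avgE integral_cst// -[X in _ * (_ * X)](fineK fB) -!EFinM mulrCA.
by rewrite mulVf ?mulr1// gt_eqF.
Qed.

Lemma avg_fin_num f : mu.-integrable B f -> avg mu B f \is a fin_num.
Proof. by move=> intf; rewrite avgE fin_numM// integrable_fin_num. Qed.

Lemma ge0_avg_integrable f : mfun f -> (forall x, B x -> 0 <= f x) ->
  avg mu B f < +oo -> mu.-integrable B f.
Proof.
move=> mf f0 foo; apply/integrableP; split => //.
under eq_integral => x /set_mem Bx do rewrite gee0_abs ?f0//.
rewrite -avgK lte_mul_pinfty// ?(ltW B0)//.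
Qed.

Lemma ge0_avg_le f g : mfun f -> mfun g -> (forall x, B x -> 0 <= f x) ->
  (forall x, B x -> f x <= g x) -> avg mu B f <= avg mu B g.
Proof.
move=> mf mg f0 fg; rewrite !avgE lee_wpmul2l//.
exact: ge0_le_integral.
Qed.

Lemma avg_le f g : mu.-integrable B f -> mu.-integrable B g ->
  (forall x, B x -> f x <= g x) -> avg mu B f <= avg mu B g.
Proof.
move=> intf intg fg; rewrite !avgE lee_wpmul2l//.
by apply: le_integral => // x /set_mem; exact: fg.
Qed.

Lemma avgD f g : mu.-integrable B f -> mu.-integrable B g ->
  avg mu B (f \+ g) = avg mu B f + avg mu B g.
Proof.
move=> intf intg; rewrite !avgE integralD// muleDr//.
by rewrite fin_num_adde_defl// integrable_fin_num.
Qed.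

Lemma ge0_avgD f g : mfun f -> mfun g -> (forall x, B x -> 0 <= f x) ->
  (forall x, B x -> 0 <= g x) ->
  avg mu B (f \+ g) = avg mu B f + avg mu B g.
Proof.
move=> mf mg f0 g0; rewrite !avgE ge0_integralD// ge0_muleDr//.
- exact: integral_ge0.
- exact: integral_ge0.
Qed.

Lemma ge0_avgZl c f : (0 <= c)%R -> mfun f -> (forall x, B x -> 0 <= f x) ->
  avg mu B (fun x => c%:E * f x) = c%:E * avg mu B f.
Proof. by move=> c0 mf f0; rewrite !avgE ge0_integralZl_EFin// muleCA. Qed.

Lemma integrable_subc f c : mu.-integrable B f ->
  mu.-integrable B (fun x => f x - c%:E).
Proof.
move=> intf; rewrite (_ : (fun _ => _) = f \+ cst (- c)%:E)//.
by apply: integrableD => //; exact: integrable_cst.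
Qed.

Lemma avg_subc f c : mu.-integrable B f ->
  avg mu B (fun x => f x - c%:E) = avg mu B f - c%:E.
Proof.
move=> intf; rewrite (_ : (fun _ => _) = f \+ cst (- c)%:E)// avgD//.
  by rewrite avg_cst.
exact: integrable_cst.
Qed.

Lemma abs_avg_le f : mu.-integrable B f ->
  `|avg mu B f| <= avg mu B (fun x => `|f x|).
Proof.
move=> intf; rewrite !avgE abseM gee0_abs//.
rewrite lee_wpmul2l//.
by apply: le_abse_integral => //; have /integrableP[] := intf.
Qed.

Lemma abs_avg_subc f c : mu.-integrable B f ->
  `|avg mu B f - c%:E| <= avg mu B (fun x => `|f x - c%:E|).
Proof.
by move=> intf; rewrite -avg_subc//; exact/abs_avg_le/integrable_subc.
Qed.

(** By Markov's inequality, the set [H] where the deviation is at least [2 * N] has at most half the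
    measure of [B]. *)
Lemma avg_chebyshev f c (N : R) : mu.-integrable B f -> (0 < N)%R ->
  avg mu B (fun x => `|f x - c%:E|) <= N%:E ->
  mu B <= 2%:E * mu (B `&` [set x | `|f x - c%:E| <= (2 * N)%:E]).
Proof.
move=> intf N0 hN.
have N20 : (0 < 2 * N)%R by rewrite mulr_gt0.
have /integrableP[mg _] := integrable_subc c intf.
have mag : mfun (fun x => `|f x - c%:E|).
  exact: (measurableT_comp (@abse_measurable R setT) mg).
pose G := B `&` [set x | `|f x - c%:E| <= (2 * N)%:E].
pose H := B `&` [set x | (2 * N)%:E <= `|f x - c%:E|].
have mG : measurable (G : set (borel X)).
  exact: emeasurable_fun_infty_c.
have mH : measurable (H : set (borel X)).
  exact: emeasurable_fun_c_infty.
have HN : (2 * N)%:E * mu H <= N%:E * mu B.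
  apply: le_trans (le_integral_abse mu mB mg N20) _.
  by rewrite -avgK muleC lee_wpmul2r// ltW.
have BGH : mu B <= mu G + mu H.
  apply: (@le_trans _ _ (mu (G `|` H))); last exact: measureU2.
  apply: le_mu => //; first exact: measurableU.
  by move=> x Bx; have [|/ltW] := leP `|f x - c%:E| (2 * N)%:E; [left|right].
have fG : mu G \is a fin_num.
  rewrite ge0_fin_numE//; apply: le_lt_trans Boo; apply: le_mu => //.
  exact: subIsetl.
have fH : mu H \is a fin_num.
  rewrite ge0_fin_numE//; apply: le_lt_trans Boo; apply: le_mu => //.
  exact: subIsetl.
rewrite -/G; move: HN BGH.
rewrite -(fineK fG) -(fineK fH) -(fineK fB) -EFinD -!EFinM !lee_fin.
set b := fine (mu B); set g := fine (mu G); set h := fine (mu H) => HN BGH.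
have : (2 * h <= b)%R by rewrite -(ler_pM2l N0) mulrCA mulrA.
have : (b <= g + h)%R by [].
lra.
Qed.

End averages.

(** * Local integrability and comparison of averages over balls *)

Section local_integrability.
Context {R : realType} {X : completeMetricType R}.
Context (mu : {measure set (borel X) -> \bar R}) (Cd : R).
Hypothesis mu_dbl : doubling_by mu Cd.
Implicit Types (f g w : X -> \bar R) (x y : X) (r s : R).

Let Cd0 : (0 < Cd)%R. Proof. exact: lt_trans mu_dbl.1. Qed.

Lemma posfin_ball x r : (0 < r)%R -> posfin mu (ball x r).
Proof.
move=> r0; split; first exact: measurable_metric_ball.
- exact: (mu_ball_gt0 mu_dbl).
- exact: (mu_ball_ltey mu_dbl).
Qed.

(** Balls have compact closure, and every compact set lies in a ball. *)
Lemma L1locP f : L1loc mu f <->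
  forall x r, (0 < r)%R -> mu.-integrable (ball x r) f.
Proof.
split => [lf x r r0|intf K cK].
  have cB : compact (closure (ball x r)).
    exact: (compact_closure_ball mu_dbl).
  apply: integrableS (lf _ cB); first exact: metric_compact_measurable.
  - exact: measurable_metric_ball.
  - exact: subset_closure.
have [r r0 Kr] := compact_sub_ball point cK.
apply: integrableS (intf point r r0) => //; first exact: measurable_metric_ball.
exact: metric_compact_measurable.
Qed.

(** The integral of a nonnegative function grows with the ball, and [k] doublings of the smaller
    ball cover the larger one. *)
Lemma avg_doubling k f x y r s : (0 < r)%R -> (0 < s)%R ->
  ball x r `<=` ball y s -> (mdist x y + s <= 2 ^+ k * r)%R ->
  @measurable_fun _ _ (borel X) _ (ball y s) f ->
  (forall z, ball y s z -> 0 <= f z) ->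
  avg mu (ball x r) f <= (Cd ^+ k)%:E * avg mu (ball y s) f.
Proof.
move=> r0 s0 rs h mf f0.
apply: (avg_le_mul (posfin_ball x r0)).
apply: (@le_trans _ _ (\int[mu]_(z in ball y s) f z)).
  by apply: ge0_subset_integral => //; exact: measurable_metric_ball.
rewrite -(avgK (posfin_ball y s0)) muleAC lee_wpmul2r//.
  by apply: (avg_ge0 (posfin_ball y s0)).
exact: (mu_ball_sub mu_dbl).
Qed.

(** Whatever the values [A B], superlevel sets are unions of open balls. *)
Lemma measurable_sup_over_balls (A : set X -> \bar R) (D : set X) :
  measurable (D : set (borel X)) ->
  @measurable_fun _ _ (borel X) _ D
    (fun x => ereal_sup [set A B | B in [set B | balls B /\ B x]]).
Proof.
move=> mD; apply: measurable_funTS.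
apply: (measurability _ (@ErealGenOInfty.measurableE R)).
move=> _ [_ [t ->] <-]; rewrite setTI.
set u := fun x => _.
rewrite (_ : _ @^-1` _ = \bigcup_(B in [set B | balls B /\ t%:E < A B]) B).
  apply: measurable_open; apply: bigcup_open => B [[x [r [_ ->]]] _].
  exact: open_metric_ball.
apply/seteqP; split => x /=; rewrite in_itv/= andbT.
  by move=> /ereal_sup_gt[_ [B [bB Bx] <-] tB]; exists B.
move=> [B [bB tB] Bx]; apply: (lt_le_trans tB).
by apply: ereal_sup_ubound; exists B.
Qed.

Lemma natural_max_ge f x y r : (0 < r)%R -> ball x r y ->
  avg mu (ball x r) f <= natural_max mu f y.
Proof.
move=> r0 xy; apply: ereal_sup_ubound; exists (ball x r) => //.
by split => //; exists x, r.
Qed.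

Lemma HL_max_eq w : (forall x, 0 <= w x) -> HL_max mu w = natural_max mu w.
Proof.
move=> w0; rewrite /HL_max (_ : (fun y => `|w y|) = w)//.
by apply/funext => x; rewrite gee0_abs.
Qed.

Lemma measurable_natural_max f (D : set X) : measurable (D : set (borel X)) ->
  @measurable_fun _ _ (borel X) _ D (natural_max mu f).
Proof. exact: measurable_sup_over_balls. Qed.

Lemma le_ess_inf_on (B : set X) f (c : \bar R) :
  (forall x, B x -> c <= f x) -> c <= ess_inf_on mu B f.
Proof.
move=> cf; apply/ess_infP; apply: nearW => x; rewrite /patch.
by case: ifPn => [/set_mem|_]; [exact: cf|rewrite leey].
Qed.

(** The triangle inequality gives the factor 3, rounded up to 4 so that two doublings pay for the
    dilation. *)
Lemma sub_large_ball x y z r s : (r <= s)%R -> ball x r y -> ball z s y ->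
  ball x r `<=` ball z (4 * s)%R.
Proof.
rewrite !ballEmdist/= => rs xy zy u /= xu.
have := metric_triangle z y u; have := metric_triangle y x u.
rewrite (metric_sym y x); have := mdist_ge0 z y; lra.
Qed.

Lemma small_ball_sub x y z r s : (s < r)%R -> ball x r y -> ball z s y ->
  ball z s `<=` ball x (4 * r)%R.
Proof.
rewrite !ballEmdist/= => sr xy zy u /= zu.
have := metric_triangle x y u; have := metric_triangle y z u.
rewrite (metric_sym y z); have := mdist_ge0 x y; lra.
Qed.

End local_integrability.

(** * Maximal functions *)

Section maximal_estimate.
Context {R : realType} {X : completeMetricType R}.
Context (mu : {measure set (borel X) -> \bar R}) (Cd : R).
Hypothesis mu_dbl : doubling_by mu Cd.
Implicit Types (f g w : X -> \bar R) (x y : X) (r s : R).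

Let Cd0 : (0 < Cd)%R. Proof. exact: lt_trans mu_dbl.1. Qed.

(** The common core of both applications. Balls of radius at least [r] contribute at most [M].
    Smaller ones meeting [ball x r] lie in [ball x (4 * r)] and exceed [M] by at most [k] times [a],
    whose supremum is controlled in mean by [g]. Three powers of [Cd] come from the covering, two
    from returning to radius [r]. *)
Lemma natural_max_estimate f g (a : X -> R -> R) (M k e : R) x r :
  (0 < r)%R -> (0 <= k)%R -> (0 < e)%R ->
  @measurable_fun _ _ (borel X) _ (ball x (4 * r)%R) g ->
  (forall y, ball x (4 * r)%R y -> 0 <= g y) ->
  (forall y z s, (r <= s)%R -> ball x r y -> ball z s y ->
    avg mu (ball z s) f <= M%:E) ->
  (forall z s, (0 < s)%R -> ball z s `<=` ball x (4 * r)%R ->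
    avg mu (ball z s) f <= (M + k * a z s)%:E /\
    mu (ball z s) <= 2%:E * mu (ball z s `&` [set y | (a z s)%:E <= g y])) ->
  exists u : X -> \bar R, [/\ @measurable_fun _ _ (borel X) _ (ball x r) u,
    forall y, 0 <= u y,
    forall y, ball x r y -> natural_max mu f y <= M%:E + u y &
    avg mu (ball x r) u <=
      (2 * Cd ^+ 5 * k)%:E * (e%:E + avg mu (ball x (4 * r)%R) g)].
Proof.
set S := ball x (4 * r)%R; move=> r0 k0 e0 mg g0 large small.
pose F : set (X * R) := [set p | (0 < p.2 <= r)%R /\ ball p.1 p.2 `<=` S].
pose v := sup_balls F (fun p => a p.1 p.2).
have v0 y : 0 <= v y by exact: sup_balls_ge0.
have r40 : (0 < 4 * r)%R by rewrite mulr_gt0.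
have [mS _ Soo] := posfin_ball mu_dbl x r40.
have pB := posfin_ball mu_dbl x r0.
have pS := posfin_ball mu_dbl x r40.
have mv D : measurable (D : set (borel X)) ->
    @measurable_fun _ _ (borel X) _ D v.
  by move=> mD; exact: measurable_sup_balls.
have intv : \int[mu]_(y in S) v y <=
    (2 * Cd ^+ 3)%:E * (e%:E * mu S + \int[mu]_(y in S) g y).
  apply: (integral_sup_balls mu_dbl (rho := r)) => //.
  - by move=> p [].
  - by move=> p [_].
  - by move=> p [/andP[p0 _] pS']; have [] := small _ _ p0 pS'.
have C30 : (0 <= 2 * Cd ^+ 3)%R by rewrite mulr_ge0// exprn_ge0// ltW.
have avgv : avg mu S v <= (2 * Cd ^+ 3)%:E * (e%:E + avg mu S g).
  apply: (avg_le_mul pS); apply: (le_trans intv).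
  rewrite -muleA lee_wpmul2l ?lee_fin// -(avgK pS).
  rewrite [mu S * avg _ _ _]muleC -ge0_muleDl ?lee_fin ?(ltW e0)//.
  exact: (avg_ge0 pS).
exists (fun y => k%:E * v y); split.
- by apply: measurable_funeM; apply: mv; case: pB.
- by move=> y; rewrite mule_ge0// lee_fin.
- move=> y xy; apply: ge_ereal_sup => _ [_ [[z [s [s0 ->]] zy] <-]].
  have [rs|sr] := leP r s.
    apply: le_trans (large _ _ _ rs xy zy) _.
    by rewrite leeDl// mule_ge0// lee_fin.
  have zS := small_ball_sub sr xy zy.
  have [h _] := small z s s0 zS; apply: (le_trans h).
  rewrite EFinD EFinM leeD2l// lee_wpmul2l ?lee_fin//.
  have Fp : F (z, s) by split => //=; rewrite s0 ltW.
  exact: (sup_balls_ge (fun p => a p.1 p.2) Fp).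
- have h : avg mu (ball x r) v <= (Cd ^+ 2)%:E * avg mu S v.
    apply: (avg_doubling mu_dbl) => //; last exact: mv.
      by apply: sub_ball; rewrite mdistxx; lra.
    by rewrite mdistxx; lra.
  rewrite (ge0_avgZl pB)//; last by apply: mv; case: pB.
  have -> : (2 * Cd ^+ 5 * k)%:E = k%:E * ((Cd ^+ 2)%:E * (2 * Cd ^+ 3)%:E).
    by rewrite -!EFinM; congr EFin; ring.
  rewrite -!muleA lee_wpmul2l ?lee_fin//; apply: (le_trans h).
  by rewrite lee_wpmul2l// lee_fin exprn_ge0// ltW.
Qed.

End maximal_estimate.

(** * Weights *)

(** The left side is the logarithm of the right side, and [s <= expR s]. *)
Lemma lne_sub_le {R : realType} (a : R) (t : \bar R) : 0 <= t ->
  lne t - a%:E <= (expR (- a))%:E * t.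
Proof.
case: t => [t| |//]; last by rewrite mulry gtr0_sg ?mul1e ?expR_gt0 ?leey.
rewrite lee_fin le_eqVlt => /predU1P[<-|t0].
  by rewrite le0_lneNy// addNye leNye.
rewrite lne_EFin// -EFinB -EFinM lee_fin.
have -> : (expR (- a) * t = expR (ln t - a))%R.
  by rewrite addrC expRD lnK// posrE.
by apply: le_trans (expR_ge1Dx _); rewrite lerDr.
Qed.

Section weights.
Context {R : realType} {X : completeMetricType R}.
Context (mu : {measure set (borel X) -> \bar R}) (Cd : R).
Hypothesis mu_dbl : doubling_by mu Cd.
Context (w : X -> \bar R).
Hypothesis w_weight : weight mu w.
Implicit Types (x y z : X) (r s : R).

Let Cd0 : (0 < Cd)%R. Proof. exact: lt_trans mu_dbl.1. Qed.

Let w0 x : 0 <= w x. Proof. by case: w_weight. Qed.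

Let intw x r : (0 < r)%R -> mu.-integrable (ball x r) w.
Proof. by case: w_weight => /(L1locP mu_dbl) + _ _; exact. Qed.

Let mw x r : (0 < r)%R -> @measurable_fun _ _ (borel X) _ (ball x r) w.
Proof. by move=> /(intw x)/integrableP[]. Qed.

(** A zero average would make [w] vanish almost everywhere on the ball, and the ball would be null
    because [w] is positive almost everywhere. *)
Lemma weight_avg_gt0 x r : (0 < r)%R -> 0 < avg mu (ball x r) w.
Proof.
move=> r0; have pB := posfin_ball mu_dbl x r0; have [mB B0 _] := pB.
rewrite lt0e (avg_ge0 pB) ?andbT//; apply/negP => /eqP avg0.
have : \int[mu]_(y in ball x r) `|w y| = 0.
  under eq_integral do rewrite gee0_abs//.
  by rewrite -(avgK pB) avg0 mule0.
move=> /(ae_eq_integral_abs mu mB (mw r0)) w00.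
have [_ _ wpos] := w_weight.
suff h : {ae mu, forall y : borel X, ~ ball x r y}.
  have : mu.-negligible (ball x r).
    apply: negligibleS h => y /= xy; exact.
  by move=> /(negligibleP _ mB) {}h; rewrite h ltxx in B0.
apply: filterS2 w00 wpos => y /= yB0 yw By.
by have := yB0 By => wy0; rewrite wy0 ltxx in yw.
Qed.

Context (K : R).
Hypothesis K1 : (1 <= K)%R.
Hypothesis wK : forall x r, (0 < r)%R -> avg mu (ball x r) w *
   expeR (- avg mu (ball x r) (fun y => lne (w y))) <= K%:E.

Let K0 : (0 < K)%R. Proof. exact: lt_le_trans K1. Qed.

Let mlw x r : (0 < r)%R ->
  @measurable_fun _ _ (borel X) _ (ball x r) (fun y => lne (w y)).
Proof. by move=> r0; exact: (measurableT_comp (@measurable_lne R) (mw r0)). Qed.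

(** The positive part of [log w] is at most [w]. If the negative part had infinite integral, the
    exponential factor in [wK] would be [+oo]; its product with the positive average of [w] would be
    infinite too. *)
Lemma integrable_lne x r : (0 < r)%R ->
  mu.-integrable (ball x r) (fun y => lne (w y)).
Proof.
move=> r0; have pB := posfin_ball mu_dbl x r0; have [mB B0 Boo] := pB.
pose l : borel X -> \bar R := fun y => lne (w y).
have ml : measurable_fun (ball x r : set (borel X)) l by exact: mlw.
have posoo : \int[mu]_(y in ball x r) l^\+ y < +oo.
  apply: (@le_lt_trans _ _ (\int[mu]_(y in ball x r) w y)).
    apply: ge0_le_integral => //; first exact: measurable_funepos.
      exact: mw.
    by move=> y _; rewrite funeposE ge_max lne_le// w0.
  have := integrable_fin_num mB (intw x r0).
  by rewrite ge0_fin_numE// integral_ge0.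
have negoo : \int[mu]_(y in ball x r) l^\- y < +oo.
  rewrite ltNge leye_eq; apply/negP => /eqP neg.
  have lNy : avg mu (ball x r) l = -oo.
    rewrite (avgE pB) integralE neg.
    have : \int[mu]_(y in ball x r) l^\+ y \is a fin_num.
      by rewrite ge0_fin_numE// integral_ge0.
    move=> /fineK <- /=; rewrite addeNy// mulrNy gtr0_sg ?mul1e//.
    by rewrite invr_gt0 fine_gt0// B0.
  have := wK x r0; rewrite -/l lNy /= gt0_muley; last exact: weight_avg_gt0.
  by rewrite leNgt ltry.
apply/integrableP; split => //.
rewrite (_ : (fun y => `|l y|) = l^\+ \+ l^\-); last exact: fune_abse.
rewrite ge0_integralD//.
- exact: lte_add_pinfty.
- exact: measurable_funepos.
- exact: measurable_funeneg.
Qed.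

(* With s := log w - a of mean zero, the mean of |s| is twice that of the
   positive part of s, which is at most exp s. *)
Lemma avg_lne_bounds x r : (0 < r)%R -> exists a : R,
  [/\ avg mu (ball x r) (fun y => lne (w y)) = a%:E,
      avg mu (ball x r) w <= (K * expR a)%:E &
      avg mu (ball x r) (fun y => `|lne (w y) - a%:E|) <= (2 * K)%:E].
Proof.
move=> r0; have pB := posfin_ball mu_dbl x r0; have [mB B0 Boo] := pB.
pose l : borel X -> \bar R := fun y => lne (w y).
have il := integrable_lne x r0.
have /fineK := avg_fin_num pB il; set a := fine _ => aE.
have wa : avg mu (ball x r) w <= (K * expR a)%:E.
  have := wK x r0; rewrite -aE /= => h.
  have e0 : (0 < expR (- a))%R by exact: expR_gt0.
  move: h; rewrite muleC -lee_pdivlMl// => /le_trans; apply.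
  by rewrite -EFinM lee_fin expRN invrK mulrC.
exists a; split => //.
pose s y := l y - a%:E.
have is_ : mu.-integrable (ball x r) s by exact: integrable_subc.
have ms : measurable_fun (ball x r : set (borel X)) s.
  by have /integrableP[] := is_.
have avgs : avg mu (ball x r) s = 0.
  by rewrite /s (avg_subc pB)// -aE -EFinB subrr.
have ints : \int[mu]_(y in ball x r) s y = 0.
  by rewrite -(avgK pB) avgs mule0.
have posE : \int[mu]_(y in ball x r) s^\- y = \int[mu]_(y in ball x r) s^\+ y.
  have := ints; rewrite integralE.
  have fp := integrable_pos_fin_num mB is_.
  have fn := integrable_neg_fin_num mB is_.
  by rewrite -(fineK fp) -(fineK fn) -EFinB => -[] /subr0_eq ->.
have absE : avg mu (ball x r) (fun y => `|s y|) = 2%:E * avg mu (ball x r) s^\+.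
  rewrite (_ : (fun y => `|s y|) = s^\+ \+ s^\-); last exact: fune_abse.
  rewrite !(avgE pB) ge0_integralD//; last 2 first.
  - exact: measurable_funepos.
  - exact: measurable_funeneg.
  by rewrite posE -mule2n muleCA -mule_natl.
rewrite absE EFinM lee_wpmul2l//.
apply: (@le_trans _ _ (avg mu (ball x r) (fun y => (expR (- a))%:E * w y))).
  apply: (ge0_avg_le pB) => //; first exact: measurable_funepos.
    by apply: measurable_funeM; exact: mw.
  move=> y _; rewrite funeposE ge_max mule_ge0 ?lee_fin ?expR_ge0// andbT.
  exact: lne_sub_le.
rewrite (ge0_avgZl pB) ?expR_ge0//; last exact: mw.
rewrite -lee_pdivlMl ?expR_gt0//; apply: (le_trans wa).
by rewrite -EFinM lee_fin expRN invrK mulrC.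
Qed.

Lemma BMO_lne : BMO mu (fun y => lne (w y)).
Proof.
split; first by apply/(L1locP mu_dbl) => x r r0; exact: integrable_lne.
apply: (@le_lt_trans _ _ (2 * K)%:E); last by rewrite ltry.
apply: ge_ereal_sup => _ [_ [x [r [r0 ->]]] <-].
by have [a [-> _]] := avg_lne_bounds x r0.
Qed.

(** Transfers finiteness from the maximal function of [log w] to that of [w]; on each ball it is the
    bound of the average of [w] by [K] times the exponential of the mean of [log w]. *)
Lemma natural_max_le_expeR x :
  natural_max mu w x <= K%:E * expeR (natural_max mu (fun y => lne (w y)) x).
Proof.
apply: ge_ereal_sup => _ [_ [[z [s [s0 ->]]] zx] <-].
have [a [aE wa _]] := avg_lne_bounds z s0; apply: (le_trans wa).
rewrite EFinM lee_wpmul2l ?lee_fin ?(ltW K0)//.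
by rewrite -[(expR a)%:E]/(expeR a%:E) lee_expeR -aE natural_max_ge.
Qed.

Lemma natural_max_weight_gt0 x : 0 < natural_max mu w x.
Proof.
apply: lt_le_trans (natural_max_ge mu w ltr01 (ballxx x ltr01)).
exact: weight_avg_gt0.
Qed.

(** On at least half of the ball [log w] is within [4 * K] of its mean [a], so that
    [w >= expR (a - 4 * K)], while the average of [w] is at most [K * expR a]. The quotient of these
    bounds is [c]. *)
Lemma weight_large_part : exists2 c : R, (0 < c)%R &
  forall x r, (0 < r)%R -> mu (ball x r) <= 2%:E *
    mu (ball x r `&` [set y | (c * fine (avg mu (ball x r) w))%:E <= w y]).
Proof.
pose c := (expR (- (4 * K)) / K)%R.
exists c => [|x r r0]; first by rewrite divr_gt0// expR_gt0.
 have pB := posfin_ball mu_dbl x r0; have [mB B0 Boo] := pB.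
have [a [aE wa osc]] := avg_lne_bounds x r0.
have K20 : (0 < 2 * K)%R by rewrite mulr_gt0.
apply: le_trans (avg_chebyshev pB (integrable_lne x r0) K20 osc) _.
rewrite lee_wpmul2l//; apply: le_mu.
- have /integrableP[ms _] := integrable_subc pB a (integrable_lne x r0).
  have mas := measurableT_comp (@abse_measurable R setT) ms.
  exact: (emeasurable_fun_infty_c mB mas).
- by apply: emeasurable_fun_c_infty => //; exact: mw.
move=> y [xy]; rewrite /= => h; split => //=.
have la : (a - 2 * (2 * K))%:E <= lne (w y).
  move: h; case: (lne (w y)) => [l| |] //=; rewrite ?leey//.
  by rewrite !lee_fin ler_norml => /andP[+ _]; rewrite lerBrDr addrC.
have lw : (expR (a - 2 * (2 * K)))%:E <= w y.
  rewrite -[w y]lneK ?in_itv/= ?w0 ?leey//.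
  by rewrite -[(expR _)%:E]/(expeR _%:E) lee_expeR.
apply: le_trans lw; rewrite lee_fin /c.
have := wa; rewrite -(fineK (avg_fin_num pB (intw x r0))) lee_fin.
set t := fine _ => ta.
rewrite (_ : 2 * (2 * K) = 4 * K)%R; last by ring.
rewrite addrC expRD -mulrA ler_pM2l ?expR_gt0// mulrC ler_pdivrMr// mulrC.
exact: ta.
Qed.

(** The [A1] inequality in pointwise form: the value at an arbitrary point of the ball replaces the
    essential infimum. *)
Lemma avg_natural_max_le : exists2 C : R, (0 < C)%R &
  forall x r y, (0 < r)%R -> ball x r y ->
  avg mu (ball x r) (natural_max mu w) <= C%:E * natural_max mu w y.
Proof.
have [c c0 large] := weight_large_part.
exists (Cd ^+ 2 + 4 * Cd ^+ 5 / c)%R.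
  by rewrite addr_gt0 ?divr_gt0 ?mulr_gt0 ?exprn_gt0//.
move=> x r y r0 xy.
have C20 : (0 < Cd ^+ 2)%R by rewrite exprn_gt0.
have C50 : (0 < 4 * Cd ^+ 5 / c)%R by rewrite divr_gt0 ?mulr_gt0 ?exprn_gt0//.
have := natural_max_weight_gt0 y.
case E : (natural_max mu w y) => [m| |]//; last first.
  by move=> _; rewrite gt0_muley ?leey// lte_fin addr_gt0.
rewrite lte_fin => m0.
have pB := posfin_ball mu_dbl x r0; have [mB B0 Boo] := pB.
have r40 : (0 < 4 * r)%R by rewrite mulr_gt0.
have pS := posfin_ball mu_dbl x r40.
have Sy : ball x (4 * r)%R y by apply: le_ball xy; lra.
have wS : avg mu (ball x (4 * r)%R) w <= m%:E by rewrite -E natural_max_ge.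
(* Large balls pass through [y] after dilation by 4, whence [Cd ^+ 2 * m]. On small balls [w] is at
   least [c] times the average on half the ball, and the factor [c^-1] restores the average. The
   error [m] equals the bound on the average of [w] over [ball x (4 * r)]. *)
have [||||||u [mu_ u0 natu avgu]] := @natural_max_estimate _ _ mu _ mu_dbl w w
  (fun z s => c * fine (avg mu (ball z s) w))%R (Cd ^+ 2 * m)%R c^-1%R m x r r0.
- by rewrite invr_ge0 ltW.
- by [].
- exact: mw.
- by [].
- move=> t z s rs xt zt.
  have s0 : (0 < s)%R by exact: lt_le_trans rs.
  have s40 : (0 < 4 * s)%R by rewrite mulr_gt0.
  have zy : ball z (4 * s)%R y by apply: (sub_large_ball rs xt zt).
  apply: (@le_trans _ _ ((Cd ^+ 2)%:E * avg mu (ball z (4 * s)%R) w)).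
    apply: (avg_doubling mu_dbl) => //; last exact: mw.
      by apply: sub_ball; rewrite mdistxx; lra.
    by rewrite mdistxx; lra.
  rewrite [(_ * m)%:E]EFinM lee_wpmul2l ?lee_fin ?(ltW C20)//.
  by rewrite -E natural_max_ge.
- move=> z s s0 zS; split; last exact: large.
  rewrite mulrA mulVf ?gt_eqF// mul1r EFinD fineK.
    by rewrite leeDr// lee_fin mulr_ge0// ltW.
  exact: (avg_fin_num (posfin_ball mu_dbl z s0) (intw z s0)).
apply: (@le_trans _ _ (avg mu (ball x r) (cst (Cd ^+ 2 * m)%:E \+ u))).
  apply: (ge0_avg_le pB) => //.
  - exact: measurable_natural_max.
  - by apply: emeasurable_funD => //; exact: measurable_cst.
  - by move=> z _; exact/ltW/natural_max_weight_gt0.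
rewrite (ge0_avgD pB)//; last by move=> z _; rewrite lee_fin mulr_ge0// ltW.
rewrite (avg_cst pB) -EFinM mulrDl EFinD leeD2l//; apply: (le_trans avgu).
apply: (@le_trans _ _ ((2 * Cd ^+ 5 * c^-1)%:E * (m%:E + m%:E))).
  rewrite lee_wpmul2l ?leeD2l// lee_fin mulr_ge0 ?invr_ge0 ?(ltW c0)//.
  by rewrite ltW// mulr_gt0// exprn_gt0.
by rewrite -EFinD -!EFinM lee_fin; lra.
Qed.

(** One point of finiteness in each ball gives local integrability through the pointwise estimate,
    which also yields the [A1] bound. *)
Lemma A1_HL_max :
  (forall x r, (0 < r)%R -> exists2 y, ball x r y & natural_max mu w y < +oo) ->
  A1 mu (HL_max mu w).
Proof.
move=> fin; rewrite HL_max_eq//; have [C C0 hC] := avg_natural_max_le.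
split; [split|].
- apply/(L1locP mu_dbl) => x r r0; have [y xy yoo] := fin x r r0.
  have pB := posfin_ball mu_dbl x r0; have [mB _ _] := pB.
  apply: (ge0_avg_integrable pB).
  + exact: measurable_natural_max.
  + by move=> z _; exact/ltW/natural_max_weight_gt0.
  + apply: le_lt_trans (hC x r y r0 xy) _.
    by rewrite lte_mul_pinfty// ?lee_fin ?(ltW C0)//.
- by move=> x; exact/ltW/natural_max_weight_gt0.
- by apply: nearW => x; exact: natural_max_weight_gt0.
exists C => _ [x [r [r0 ->]]].
rewrite -lee_pdivrMl//; apply: le_ess_inf_on => y xy.
by rewrite lee_pdivrMl//; exact: hC.
Qed.

End weights.

(** * Functions of bounded mean oscillation *)

Section oscillation.
Context {R : realType} {X : completeMetricType R}.
Context (mu : {measure set (borel X) -> \bar R}) (Cd : R).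
Hypothesis mu_dbl : doubling_by mu Cd.
Context (f : X -> \bar R).
Hypothesis f_loc : L1loc mu f.
Context (N : R).
Hypothesis N0 : (0 < N)%R.
Hypothesis fN : BMO_norm mu f <= N%:E.
Implicit Types (x y z : X) (r s : R).

Let Cd0 : (0 < Cd)%R. Proof. exact: lt_trans mu_dbl.1. Qed.

Let intf x r : (0 < r)%R -> mu.-integrable (ball x r) f.
Proof. by move: f_loc => /(L1locP mu_dbl); exact. Qed.

Let mf x r : (0 < r)%R -> @measurable_fun _ _ (borel X) _ (ball x r) f.
Proof. by move=> /(intf x)/integrableP[]. Qed.

Let c x r : R := fine (avg mu (ball x r) f).

Let cE x r : (0 < r)%R -> avg mu (ball x r) f = (c x r)%:E.
Proof.
move=> r0; rewrite /c fineK//.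
exact: (avg_fin_num (posfin_ball mu_dbl x r0) (intf x r0)).
Qed.

Let mosc x r (t : R) : (0 < r)%R ->
  @measurable_fun _ _ (borel X) _ (ball x r) (fun y => `|f y - t%:E|).
Proof.
move=> r0; have pB := posfin_ball mu_dbl x r0.
have /integrableP[ms _] := integrable_subc pB t (intf x r0).
exact: (measurableT_comp (@abse_measurable R setT) ms).
Qed.

Lemma BMO_osc x r : (0 < r)%R ->
  avg mu (ball x r) (fun y => `|f y - (c x r)%:E|) <= N%:E.
Proof.
move=> r0; apply: le_trans fN; apply: ereal_sup_ubound.
by exists (ball x r); [exists x, r|rewrite cE].
Qed.

(** The two averages differ by at most the mean of [|f - c y s|] over the smaller ball, which is at
    most [Cd ^+ k] times its mean over the larger one. *)
Lemma BMO_avg_doubling x y r s k : (0 < r)%R -> (0 < s)%R ->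
  ball x r `<=` ball y s -> (mdist x y + s <= 2 ^+ k * r)%R ->
  avg mu (ball x r) f <= avg mu (ball y s) f + (Cd ^+ k * N)%:E.
Proof.
move=> r0 s0 rs h; have pB := posfin_ball mu_dbl x r0.
rewrite cE// (cE y)// -EFinD lee_fin -lerBlDl.
apply: (le_trans (ler_norm _)); rewrite -lee_fin.
have := abs_avg_subc pB (c y s) (intf x r0); rewrite cE// => /le_trans; apply.
apply: le_trans (_ : (Cd ^+ k)%:E *
  avg mu (ball y s) (fun z => `|f z - (c y s)%:E|) <= _).
  by apply: (avg_doubling mu_dbl) => //; exact: mosc.
by rewrite EFinM lee_wpmul2l ?BMO_osc// lee_fin exprn_ge0// ltW.
Qed.

(** The BLO bound in pointwise form. Since this maximal function may be negative, averages are
    compared through its integrability. *)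
Lemma avg_natural_max_BMO x r y : (0 < r)%R -> ball x r y ->
  mu.-integrable (ball x r) (natural_max mu f) ->
  avg mu (ball x r) (natural_max mu f) <=
  natural_max mu f y + ((Cd ^+ 2 + 2 + 4 * Cd ^+ 5) * N)%:E.
Proof.
move=> r0 xy intM.
have r40 : (0 < 4 * r)%R by rewrite mulr_gt0.
have Sy : ball x (4 * r)%R y by apply: le_ball xy; lra.
have cS : (c x (4 * r)%R)%:E <= natural_max mu f y.
  by rewrite -cE// natural_max_ge.
(* The value [-oo] is excluded by the finite average below it, and for [+oo] the bound is
   trivial. *)
case E : (natural_max mu f y) cS => [m| |] cS //; last by rewrite addye// leey.
rewrite lee_fin in cS.
have pB := posfin_ball mu_dbl x r0; have [mB B0 Boo] := pB.
have pS := posfin_ball mu_dbl x r40.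
have C20 : (0 < Cd ^+ 2 * N)%R by rewrite mulr_gt0 ?exprn_gt0.
(* On half of a small ball [f] is at least its average there minus [2 * N]; this loss is built into
   [a] and put back in [M]. Large balls, dilated to pass through [y], account for
   [m + Cd ^+ 2 * N]. *)
have [||||||u [mu_ u0 natu avgu]] := @natural_max_estimate _ _ mu _ mu_dbl f
  (fun z => `|f z - (c x (4 * r)%R)%:E|)
  (fun z s => c z s - c x (4 * r) - 2 * N)%R
  (m + Cd ^+ 2 * N + 2 * N)%R 1%R N x r r0.
- by [].
- by [].
- exact: mosc.
- by [].
- move=> t z s rs xt zt.
  have s0 : (0 < s)%R by exact: lt_le_trans rs.
  have s40 : (0 < 4 * s)%R by rewrite mulr_gt0.
  have zy : ball z (4 * s)%R y by apply: (sub_large_ball rs xt zt).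
  apply: (@le_trans _ _ (avg mu (ball z (4 * s)%R) f + (Cd ^+ 2 * N)%:E)).
    apply: BMO_avg_doubling => //.
      by apply: sub_ball; rewrite mdistxx; lra.
    by rewrite mdistxx; lra.
  rewrite -addrA EFinD; apply: leeD; first by rewrite -E natural_max_ge.
  by rewrite lee_fin lerDl mulr_ge0// ltW.
- move=> z s s0 zS; split.
    by rewrite cE// lee_fin; lra.
  apply: le_trans (avg_chebyshev (posfin_ball mu_dbl z s0) (intf z s0) N0
    (BMO_osc z s0)) _.
  have [mBz _ _] := posfin_ball mu_dbl z s0.
  rewrite lee_wpmul2l//; apply: le_mu.
  + exact: (emeasurable_fun_infty_c mBz (@mosc z s _ s0)).
  + exact: (emeasurable_fun_c_infty mBz (@mosc z s _ s0)).
  move=> t [zt]; rewrite /= => h; split => //=.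
  move: h; case: (f t) => [l| |] //=; rewrite ?leey// !lee_fin ler_norml.
  by move=> /andP[h _]; apply: le_trans (ler_norm _); lra.
have fu : avg mu (ball x r) u < +oo.
  apply: (le_lt_trans avgu); rewrite lte_mul_pinfty//.
  - by rewrite lee_fin mulr1 mulr_ge0// exprn_ge0// ltW.
  - apply: lte_add_pinfty; first by rewrite ltry.
    exact: (le_lt_trans (BMO_osc _ r40) (ltry _)).
have intu := ge0_avg_integrable pB mu_ (fun y _ => u0 y) fu.
apply: (@le_trans _ _
    (avg mu (ball x r) (cst (m + Cd ^+ 2 * N + 2 * N)%:E \+ u))).
  apply: (avg_le pB) => //.
  by apply: integrableD => //; exact: (integrable_cst pB).
rewrite (avgD pB) ?(integrable_cst pB)// (avg_cst pB).
apply: (@le_trans _ _ ((m + Cd ^+ 2 * N + 2 * N)%:E +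
    (2 * Cd ^+ 5 * 1)%:E * (N%:E + N%:E))).
  rewrite leeD2l//; apply: (le_trans avgu).
  rewrite lee_wpmul2l ?leeD2l ?BMO_osc// lee_fin mulr1.
  by rewrite mulr_ge0// exprn_ge0// ltW.
by rewrite -!EFinD lee_fin; lra.
Qed.

Lemma natural_max_BLO :
  (forall x r, (0 < r)%R -> mu.-integrable (ball x r) (natural_max mu f)) ->
  BLO_norm mu (natural_max mu f) <=
    ((Cd ^+ 2 + 2 + 4 * Cd ^+ 5) * N)%:E.
Proof.
move=> intM; apply: ge_ereal_sup => _ [_ [x [r [r0 ->]]] <-].
have h y : ball x r y -> _ := fun xy => avg_natural_max_BMO r0 xy (intM x r r0).
have pB := posfin_ball mu_dbl x r0.
have := avg_fin_num pB (intM x r r0).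
move: h; case: (avg _ _ _) => // v h _.
set C := (_ * N)%R in h *.
have : (v - C)%:E <= ess_inf_on mu (ball x r) (natural_max mu f).
  apply: le_ess_inf_on => y xy.
  by rewrite EFinB leeBlDr//; exact: h.
case: (ess_inf_on _ _ _) => [e| |]//; last by rewrite addeNy leNye.
by rewrite -EFinB !lee_fin; lra.
Qed.

Let w y : \bar R := 1 + `|f y|.

(** Let [d] be the deviation of [f] from its average [c x r] and [T = 1 + |c x r|]. Then
    [w <= T + d], and [T <= w + d <= w (1 + d) <= w exp d] because [w >= 1]. Hence the mean of [w]
    is at most [T + N] and that of [log w] at least [ln T - N], while [T + N <= T (1 + N)] because
    [T >= 1]. *)
Lemma Ainfty_one_plus_abs : Ainfty mu w.
Proof.
have w1 y : 1 <= w y by rewrite leeDl.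
have mabsf x r : (0 < r)%R ->
    @measurable_fun _ _ (borel X) _ (ball x r) (fun y => `|f y|).
  move=> r0.
  exact: (measurableT_comp (@abse_measurable R setT) (@mf x _ r0)).
have intw x r : (0 < r)%R -> mu.-integrable (ball x r) w.
  move=> r0; have pB := posfin_ball mu_dbl x r0; have [mB _ _] := pB.
  apply: (@integrableD _ _ _ _ _ mB (cst 1) (fun y => `|f y|)).
    exact: (integrable_cst pB).
  exact: integrable_abse (intf x r0).
split.
  split; first exact/(L1locP mu_dbl).
  - by move=> y; exact: le_trans (w1 y).
  - by apply: nearW => y; exact: lt_le_trans (w1 y).
apply: (@le_lt_trans _ _ ((1 + N) * expR N)%:E); last by rewrite ltry.
apply: ge_ereal_sup => _ [_ [x [r [r0 ->]]] <-].
have pB := posfin_ball mu_dbl x r0; have [mB _ _] := pB.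
have l0 y : 0 <= lne (w y).
  by rewrite -(@lne1 R) lee_lne ?in_itv/= ?leey ?andbT// (le_trans _ (w1 y)).
have ml : @measurable_fun _ _ (borel X) _ (ball x r) (fun y => lne (w y)).
  have /integrableP[mw _] := intw x r r0.
  exact: (measurableT_comp (@measurable_lne R) mw).
have intl : mu.-integrable (ball x r) (fun y => lne (w y)).
  apply: (le_integrable mB ml _ (intw x r r0)) => y xy.
  rewrite !gee0_abs//; first by rewrite lne_le// (le_trans _ (w1 y)).
  by rewrite (le_trans _ (w1 y)).
pose T := (1 + `|c x r|)%R.
have T1 : (1 <= T)%R by rewrite lerDl.
have T0 : (0 < T)%R by exact: lt_le_trans T1.
pose d y := `|f y - (c x r)%:E|.
have intd : mu.-integrable (ball x r) d.
  exact/integrable_abse/(integrable_subc pB)/intf.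
have absf (l : R) : (`|l| <= `|c x r| + `|l - c x r|)%R.
  by rewrite -[l in leLHS](subrKC (c x r)); exact: ler_normD.
have absc (l : R) : (`|c x r| <= `|l| + `|l - c x r|)%R.
  by rewrite distrC -[c x r in leLHS](subrKC l); exact: ler_normD.
have wT : avg mu (ball x r) w <= (T + N)%:E.
  apply: (@le_trans _ _ (avg mu (ball x r) (cst T%:E \+ d))).
    apply: (avg_le pB); first exact: intw.
      by apply: integrableD => //; exact: (integrable_cst pB).
    move=> y _; rewrite /w /d /=; case: (f y) => [l| |] //=.
    by rewrite -EFinD lee_fin /T -addrA lerD2l.
  rewrite (avgD pB) ?(integrable_cst pB)// (avg_cst pB).
  rewrite [(T + N)%:E]EFinD leeD2l//.
  exact: BMO_osc.
have lT : (ln T)%:E <= avg mu (ball x r) (fun y => lne (w y)) + N%:E.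
  rewrite -(avg_cst pB).
  apply: (@le_trans _ _ (avg mu (ball x r) ((fun y => lne (w y)) \+ d))).
    apply: (avg_le pB); first exact: (integrable_cst pB).
      exact: integrableD.
    move=> y _; rewrite /= /d; have := l0 y; rewrite /w.
    case: (f y) => [l| |] /= _; rewrite ?addey// ?leey//.
    have W1 : (1 <= 1 + `|l|)%R by rewrite lerDl.
    have W0 : (0 < 1 + `|l|)%R by exact: lt_le_trans W1.
    case: ifPn => [|_]; first by rewrite leNgt W0.
    rewrite lee_fin -[X in (_ <= _ + X)%R]expRK -lnM ?posrE ?expR_gt0//.
    rewrite ler_ln ?posrE ?mulr_gt0 ?expR_gt0//.
    apply: (@le_trans _ _ ((1 + `|l|) * (1 + `|l - c x r|))%R).
      rewrite mulrDr mulr1 /T -addrA lerD2l (le_trans (absc l))// lerD2l.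
      by rewrite ler_peMl.
    by rewrite ler_pM2l// expR_ge1Dx.
  rewrite (avgD pB)// leeD2l//; exact: BMO_osc.
have := avg_fin_num pB intl; move: lT.
case: (avg _ _ _) => // l; rewrite lee_fin => lT _.
apply: (@le_trans _ _ ((T + N)%:E * expeR (- l%:E))).
  by rewrite lee_wpmul2r// expeR_ge0.
rewrite -EFinN/= -EFinM lee_fin.
have : (T <= expR (l + N))%R by rewrite -[T]lnK// ler_expR.
rewrite expRD => TN.
apply: (@le_trans _ _ (T * (1 + N) * expR (- l))%R).
  rewrite ler_pM2r ?expR_gt0// mulrDr mulr1 lerD2l.
  by rewrite ler_peMl// ltW.
rewrite expRN ler_pdivrMr ?expR_gt0// mulrC -mulrA.
by rewrite ler_pM2l ?addr_gt0// mulrC.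
Qed.

End oscillation.

(** * The equivalence of the two mapping properties *)

Section equivalence.
Context {R : realType} {X : completeMetricType R}.
Context (mu : {measure set (borel X) -> \bar R}) (Cd : R).
Hypothesis mu_dbl : doubling_by mu Cd.
Implicit Types (f w : X -> \bar R).

Lemma Ainfty_bound w :
  ereal_sup [set avg mu B w * expeR (- avg mu B (fun y => lne (w y))) |
             B in balls] < +oo ->
  exists2 K : R, (1 <= K)%R & forall (x : X) (r : R), (0 < r)%R ->
    avg mu (ball x r) w *
    expeR (- avg mu (ball x r) (fun y => lne (w y))) <= K%:E.
Proof.
(* The maximum with 1 supplies the normalisation [1 <= K] used for weights. *)
set s := ereal_sup _ => sup_oo; exists (Num.max 1 (fine s))%R.
  by rewrite le_max lexx.
move=> x r r0; apply: (@le_trans _ _ s).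
  by apply: ereal_sup_ubound; exists (ball x r) => //; exists x, r.
move: sup_oo; case: s => [s| |]//= _; last by rewrite leNye.
by rewrite lee_fin le_max lexx orbT.
Qed.

Lemma BMO_lne_Ainfty w : Ainfty mu w -> BMO mu (fun y => lne (w y)).
Proof.
by move=> [ww /Ainfty_bound[K K1 wK]]; exact: (BMO_lne mu_dbl ww wK).
Qed.

(** If the maximal function of [w] were infinite throughout a ball, the exponential bound would make
    that of [log w] infinite there too, against local integrability. *)
Lemma Ainfty_A1_HL_max w : Ainfty mu w ->
  L1loc mu (natural_max mu (fun y => lne (w y))) -> A1 mu (HL_max mu w).
Proof.
move=> [ww sup_oo] lmax.
have [K K1 wK] := Ainfty_bound sup_oo.
apply: (A1_HL_max mu_dbl ww K1 wK) => x r r0.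
have pB := posfin_ball mu_dbl x r0; have [mB B0 Boo] := pB.
have /(L1locP mu_dbl)/(_ x r r0) intl := lmax.
apply: contrapT => h.
have maxy y : ball x r y -> natural_max mu (fun y => lne (w y)) y = +oo.
  move=> xy; apply: contrapT => /eqP; rewrite -ltey => loo.
  apply: h; exists y => //.
  apply: (le_lt_trans (natural_max_le_expeR mu_dbl ww K1 wK y)).
  rewrite lte_mul_pinfty ?lee_fin ?(le_trans _ K1)//.
  by rewrite ltey expeR_eqy -ltey.
have := integrable_fin_num mB intl.
rewrite (@eq_integral _ _ _ _ _ (cst +oo)); last by move=> y /set_mem/maxy.
by rewrite integral_cst// gt0_mulye.
Qed.

(** On a ball where [f] has average [c], the natural maximal function lies between [c] and the
    maximal function of [1 + |f|], which is locally integrable as a member of [A1]. *)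
Lemma L1loc_natural_max f (N : R) : (0 < N)%R -> L1loc mu f ->
  BMO_norm mu f <= N%:E ->
  A1 mu (HL_max mu (fun y => 1 + `|f y|)) ->
  L1loc mu (natural_max mu f).
Proof.
move=> N0 lf fN [[lM _ _] _]; apply/(L1locP mu_dbl) => x r r0.
have pB := posfin_ball mu_dbl x r0; have [mB B0 Boo] := pB.
have /(L1locP mu_dbl)/(_ x r r0) := lM.
rewrite HL_max_eq => [intM|y]; last by rewrite adde_ge0.
have intf y s : (0 < s)%R -> mu.-integrable (ball y s) f.
  by move: lf => /(L1locP mu_dbl); exact.
have /fineK cE := avg_fin_num pB (intf x r r0).
set c := fine _ in cE.
apply: (le_integrable mB (measurable_natural_max mu f mB) (g :=
  natural_max mu (fun y => 1 + `|f y|) \+ cst `|c|%:E)); last first.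
  by apply: integrableD => //; exact: (integrable_cst pB).
move=> y xy.
have fM : natural_max mu f y <= natural_max mu (fun y => 1 + `|f y|) y.
  apply: ge_ereal_sup => _ [_ [[z [s [s0 ->]]] zy] <-].
  apply: le_trans (natural_max_ge mu _ s0 zy).
  have pz := posfin_ball mu_dbl z s0; have [mz _ _] := pz.
  apply: (avg_le pz); first exact: intf.
    apply: (@integrableD _ _ _ _ _ mz (cst 1) (fun y => `|f y|)).
      exact: (integrable_cst pz).
    exact: integrable_abse (intf z s s0).
  by move=> t _; apply: (le_trans (lee_abs _)); rewrite leeDr.
have M0 : 0 <= natural_max mu (fun y => 1 + `|f y|) y.
  apply: le_trans (natural_max_ge mu _ r0 xy); apply: (avg_ge0 pB) => z _.
  by rewrite adde_ge0.
have cM : c%:E <= natural_max mu f y by rewrite cE natural_max_ge.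
rewrite [leRHS]gee0_abs ?adde_ge0//=.
move: fM M0 cM; case: (natural_max mu f y) => [a| |]//;
  case: (natural_max _ _ y) => [b| |]//=; rewrite ?leey// !lee_fin => ab b0 ca.
rewrite ler_norml; apply/andP; split.
  by have := ler_norm (- c); rewrite normrN; lra.
by rewrite (le_trans ab)// lerDl.
Qed.

End equivalence.

Theorem theorem1p2 (R : realType) (X : completeMetricType R)
    (mu : {measure set (borel X) -> \bar R})
    (mu_doubling : doubling mu) (mu_annular : annular_decay mu) :
  (exists C : R, forall f : X -> \bar R, BMO mu f ->
     BLO mu (natural_max mu f) /\
     BLO_norm mu (natural_max mu f) <= C%:E * BMO_norm mu f)
  <->
  (forall w : X -> \bar R, Ainfty mu w -> A1 mu (HL_max mu w)).
Proof.
have [Cd Cd1 h] := mu_doubling.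
have mu_dbl : doubling_by mu Cd by [].
split=> [[C hC] w Aw|hA].
  have [[lw _] _] := hC _ (BMO_lne_Ainfty mu_dbl Aw).
  exact: (Ainfty_A1_HL_max mu_dbl Aw).
pose C := (Cd ^+ 2 + 2 + 4 * Cd ^+ 5)%R.
have Cd0 : (0 < Cd)%R by exact: lt_trans Cd1.
have C0 : (0 < C)%R by rewrite !addr_gt0 ?mulr_gt0 ?exprn_gt0.
exists C => f [lf foo].
(* Nonnegativity excludes [-oo], so the norm is a real number [n]. *)
have := foo; have : 0 <= BMO_norm mu f.
  apply: (@le_trans _ _
    (avg mu (ball point 1%R) (fun y => `|f y - avg mu (ball point 1%R) f|))).
    by apply: (avg_ge0 (posfin_ball mu_dbl _ ltr01)).
  apply: ereal_sup_ubound; exists (ball point 1%R) => //.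
  by exists point, 1%R.
case E : (BMO_norm mu f) => [n| |]//; rewrite lee_fin => n0 _.
have loc : L1loc mu (natural_max mu f).
  (* The norm may vanish, whereas a positive bound on the oscillation is asked for. *)
  have n1 : (0 < n + 1)%R by rewrite ltr_wpDl.
  have fn1 : BMO_norm mu f <= (n + 1)%:E by rewrite E lee_fin lerDl.
  apply: (L1loc_natural_max mu_dbl n1 lf fn1); apply: hA.
  exact: (Ainfty_one_plus_abs mu_dbl lf n1 fn1).
have bound : BLO_norm mu (natural_max mu f) <= (C * n)%:E.
  (* For the same reason the estimate is applied with [n + e / C], and [e] tends to 0. *)
  apply/lee_addgt0Pr => e e0.
  have ne : (0 < n + e / C)%R by rewrite ltr_wpDl// divr_gt0.
  rewrite -EFinD (_ : C * n + e = C * (n + e / C))%R; last first.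
    by rewrite mulrDr mulrCA divff ?mulr1// gt_eqF.
  apply: (natural_max_BLO mu_dbl lf ne).
    by rewrite E lee_fin lerDl divr_ge0// ltW.
  by move=> x r r0; move: loc => /(L1locP mu_dbl); exact.
rewrite -EFinM; split => //; split => //.
exact: (le_lt_trans bound (ltry _)).
Qed.
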